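(* Let $G\rightrightarrows M$ be a regular Lie groupoid whose associated co-adjoint Lie groupoid is of the form $\mathcal{G}=O(\xi)=M\times O(\xi')\rightrightarrows M$, where $O(\xi')\subset\mathfrak{g}^{\ast}$ is a co-adjoint orbit of a Lie group $\mathfrak{G}$ with Lie algebra $\mathfrak{g}$, so that $A^{\ast}\mathcal{G}=M\times T^{\ast}_{\xi'}O(\xi')$. Let $\Pi_{A^{\ast}\mathcal{G}}$ be the linear Poisson structure on $A^{\ast}\mathcal{G}$ and $\Pi$ the Kirillov–Kostant Poisson structure on $T^{\ast}_{\xi'}O(\xi')$. Let $h:T^{\ast}_{\xi'}O(\xi')\to\mathbb{R}$ be a Hamiltonian function with Hamiltonian vector field $\mathcal{X}_h^{\Pi}$, and let $H:M\times T^{\ast}_{\xi'}O(\xi')\to\mathbb{R}$, $H(p,\lambda)=h(\lambda)$, with Hamiltonian vector field $\mathcal{X}_H^{\Pi_{A^{\ast}\mathcal{G}}}$. Then first integrals of $\mathcal{X}_H^{\Pi_{A^{\ast}\mathcal{G}}}$ correspond to first integrals of $\mathcal{X}_h^{\Pi}$: for $f\in C^\infty(T^{\ast}_{\xi'}O(\xi'))$, the function $F=(p,f)\in C^\infty(M\times T^{\ast}_{\xi'}O(\xi'))$, i.e. $F(p,\lambda)=f(\lambda)$, is a first integral of $\mathcal{X}_H^{\Pi_{A^{\ast}\mathcal{G}}}$ if and only if $f$ is a first integral of $\mathcal{X}_h^{\Pi}$.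
   Context: A Lie groupoid $G\rightrightarrows M$ with source $\alpha$ and target $\beta$ is regular if $(\beta,\alpha):G\to M\times M$ has constant rank. $G$ acts on the Lie algebroid $AI_G$ of its isotropy groupoid $I_G=\bigcup_p\alpha^{-1}(p)\cap\beta^{-1}(p)$ by $Ad_gX=\frac{d}{dt}|_{t=0}\,g\,Exp(tX)\,g^{-1}$, and on $A^{\ast}I_G$ by $\langle Ad^{\ast}_g\xi,X\rangle=\langle\xi,Ad_{g^{-1}}X\rangle$. For $\xi\in A^{\ast}I_G$ whose stabilizer $G_\xi=\{g:Ad^{\ast}_g\xi=\xi\}$ is a normal Lie subgroupoid, the co-adjoint Lie groupoid is $\mathcal{G}=O(\xi)=\{Ad_g^{\ast}\xi: g\in G\}\rightrightarrows M$ with source $\alpha'(Ad_g^{\ast}\xi)=\alpha(g)$, target $\beta'(Ad_g^{\ast}\xi)=\beta(g)$, multiplication $(Ad_g^{\ast}\xi,Ad_h^{\ast}\xi)\mapsto Ad_{gh}^{\ast}\xi$, units $p\mapsto Ad^{\ast}_{1_p}\xi$ and inversion $Ad_g^{\ast}\xi\mapsto Ad_{g^{-1}}^{\ast}\xi$. Its Lie algebroid $A\mathcal{G}=\ker T\alpha'|_{\text{units}}$ (co-adjoint Lie algebroid), with anchor $\rho'=T\beta'|_{A\mathcal{G}}$ and bracket $[\vert\,,\,\vert]'$ defined by right-invariant vector fields, is in the case $\mathcal{G}=M\times O(\xi')$ the bundle $A\mathcal{G}=M\times T_{\xi'}O(\xi')$, where $T_{\xi'}O(\xi')=\{ad^{\ast}_V\xi':V\in\mathfrak{g}\}$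 and the bracket on the sections $ad^{\ast}_V\xi'$ is $$[\vert ad_V^{\ast}\xi',ad_W^{\ast}\xi'\vert]'=ad^{\ast}_{[V,W]}\xi'.$$ Linear Poisson structure on $A^{\ast}\mathcal{G}$ (with projection $\tau'^{\ast}:A^{\ast}\mathcal{G}\to M$): for a section $X'$ of $A\mathcal{G}$ let $\hat{X'}(\delta)=\delta(X'(\tau'^{\ast}(\delta)))$. The bracket is determined by $\{\hat{X'},\hat{Y'}\}_{A^{\ast}\mathcal{G}}=-\widehat{[\vert X',Y'\vert]'}$, $\{k\circ\tau'^{\ast},\hat{X'}\}_{A^{\ast}\mathcal{G}}=(\rho'(X')(k))\circ\tau'^{\ast}$ and $\{k\circ\tau'^{\ast},l\circ\tau'^{\ast}\}_{A^{\ast}\mathcal{G}}=0$ for $k,l\in C^\infty(M)$, and $\Pi_{A^{\ast}\mathcal{G}}(dF,dK)=\{F,K\}_{A^{\ast}\mathcal{G}}$. Kirillov–Kostant structure on $T^{\ast}_{\xi'}O(\xi')$: in linear coordinates $(\mathfrak{y}_\alpha)$ associated with a basis $e'_\alpha$ of $T_{\xi'}O(\xi')$ with $[\vert e'_\alpha,e'_\beta\vert]'=C^\gamma_{\alpha\beta}e'_\gamma$, $$\Pi=-\tfrac12 C^\gamma_{\alpha\beta}\,\mathfrak{y}_\gamma\,\frac{\partial}{\partial\mathfrak{y}_\alpha}\wedge\frac{\partial}{\partial\mathfrak{y}_\beta},\qquad \{f,g\}_{K.K}=\Pi(df,dg).$$ Hamiltonian vector fields: $\mathcal{X}_H^{\Pi_{A^{\ast}\mathcal{G}}}(F)=\{F,H\}_{A^{\ast}\mathcal{G}}$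 and $\mathcal{X}_h^{\Pi}(f)=\{f,h\}_{K.K}$. A function $F$ is a first integral of $\mathcal{X}_H^{\Pi_{A^{\ast}\mathcal{G}}}$ if $\mathcal{X}_H^{\Pi_{A^{\ast}\mathcal{G}}}(F)=0$; similarly $f$ is a first integral of $\mathcal{X}_h^{\Pi}$ if $\mathcal{X}_h^{\Pi}(f)=0$. The notation $F=(p,f)$ means $F(p,\lambda)=f(\lambda)$. *)

(* Defs.v *)
From HB Require Import structures.
From mathcomp Require Import all_boot all_order all_algebra.
From mathcomp Require Import all_classical all_reals all_analysis.
Set Implicit Arguments.
Unset Strict Implicit.
Unset Printing Implicit Defensive.
Import Order.TTheory GRing.Theory Num.Theory numFieldNormedType.Exports.
Local Open Scope classical_set_scope.
Local Open Scope ring_scope.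

Definition partial (R : realType) n (i : 'I_n) (f : 'rV[R]_n -> R)
    (x : 'rV[R]_n) : R :=
  derive1 (fun t : R => f (x + t *: delta_mx 0 i)) 0.

Fixpoint Cn (R : realType) n (k : nat) (U : set 'rV[R]_n)
    (f : 'rV[R]_n -> R) : Prop :=
  (forall x, U x -> {for x, continuous f}) /\
  match k with
  | 0%N => True
  | k'.+1 => forall i : 'I_n,
      (forall x, U x ->
         derivable (fun t : R => f (x + t *: delta_mx 0 i)) 0 1) /\
      Cn k' U (partial i f)
  end.

Definition smooth_on (R : realType) n (U : set 'rV[R]_n) (f : 'rV[R]_n -> R) :=
  forall k, Cn k U f.

(* [bwd] inverts [fwd] on [dom]; both are total, with junk values elsewhere. *)
Record chart (R : realType) (T : Type) (n : nat) := Chart {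
  dom : set T;
  fwd : T -> 'rV[R]_n;
  bwd : 'rV[R]_n -> T }.

(* Raw data of a manifold.  [chart_at x] is a preferred chart around [x]: the
   tangent space T_x N is modelled by row vectors ['rV_(mdim N)], the
   coordinates of a tangent vector in [chart_at x]. *)
Record mdata (R : realType) := MData {
  pt :> choiceType;
  mdim : nat;
  atlas : set (chart R pt mdim);
  chart_at : pt -> chart R pt mdim }.

Arguments atlas {R} _ _.
Arguments chart_at {R _} _.

(* The topology is the one generated by the atlas. *)
Definition mopen (R : realType) (N : mdata R) (U : set N) :=
  forall phi, atlas N phi -> open (fwd phi @` (dom phi `&` U)).

Record manifold (R : realType) (N : mdata R) : Prop := Manifold {
  mfd_nonempty : exists x : N, True;
  mfd_open : forall phi, atlas N phi -> open (fwd phi @` dom phi);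
  mfd_cancel : forall phi, atlas N phi ->
    forall x, dom phi x -> bwd phi (fwd phi x) = x;
  mfd_chart_at : forall x, atlas N (chart_at x) /\ dom (chart_at x) x;
  mfd_compat : forall phi psi, atlas N phi -> atlas N psi ->
    open (fwd phi @` (dom phi `&` dom psi)) /\
    forall j, smooth_on (fwd phi @` (dom phi `&` dom psi))
                (fun y => fwd psi (bwd phi y) 0 j);
  mfd_hausdorff : forall x y : N, x <> y -> exists U V : set N,
    [/\ mopen U, mopen V, U x, V y & U `&` V = set0];
  mfd_countable : exists s : nat -> chart R N (mdim N),
    (forall i, atlas N (s i)) /\ forall x, exists i, dom (s i) x }.

Definition prod_chart (R : realType) (S T : Type) m n
    (phi : chart R S m) (psi : chart R T n) : chart R (S * T) (m + n) :=
  Chart [set z | dom phi z.1 /\ dom psi z.2]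
        (fun z => row_mx (fwd phi z.1) (fwd psi z.2))
        (fun y => (bwd phi (lsubmx y), bwd psi (rsubmx y))).

Definition prod_mfd (R : realType) (N P : mdata R) : mdata R :=
  @MData R (N * P)%type (mdim N + mdim P)
    [set chi | exists phi psi,
       [/\ atlas N phi, atlas P psi & chi = prod_chart phi psi]]
    (fun z => prod_chart (chart_at z.1) (chart_at z.2)).

Definition global_chart_mfd (R : realType) (T : choiceType) n
    (y : T -> 'rV[R]_n) (y' : 'rV[R]_n -> T) : mdata R :=
  @MData R T n [set Chart setT y y'] (fun=> Chart setT y y').

Definition real_line (R : realType) : mdata R :=
  @global_chart_mfd R R 1 (fun t => const_mx t) (fun y => y 0 0).

(* [f] is defined and smooth on the open set [W]. *)
Definition smooth_map_on (R : realType) (N P : mdata R) (W : set N)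
    (f : N -> P) :=
  forall phi psi, atlas N phi -> atlas P psi ->
    let D := fwd phi @` (dom phi `&` W `&` f @^-1` dom psi) in
    open D /\ forall j, smooth_on D (fun y => fwd psi (f (bwd phi y)) 0 j).

Definition smooth_map (R : realType) (N P : mdata R) (f : N -> P) :=
  smooth_map_on setT f.

(* Smoothness on an arbitrary subset: local extension to a smooth map. *)
Definition smooth_map_in (R : realType) (N P : mdata R) (S : set N)
    (f : N -> P) :=
  forall x, S x -> exists (W : set N) (F : N -> P),
    [/\ mopen W, W x, smooth_map_on W F & {in S `&` W, f =1 F}].

Definition smooth_fun (R : realType) (N : mdata R) (f : N -> R) :=
  forall phi, atlas N phi ->
    smooth_on (fwd phi @` dom phi) (fun y => f (bwd phi y)).

Definition diffeo (R : realType) (N P : mdata R) (f : N -> P) :=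
  smooth_map f /\
  exists g : P -> N, [/\ smooth_map g, cancel f g & cancel g f].

(* T_x f, acting on row vectors by right multiplication. *)
Definition tmap (R : realType) (N P : mdata R) (f : N -> P) (x : N) :
    'M[R]_(mdim N, mdim P) :=
  \matrix_(i, j) partial i
    (fun y => fwd (chart_at (f x)) (f (bwd (chart_at x) y)) 0 j)
    (fwd (chart_at x) x).

Definition dfun (R : realType) (N : mdata R) (f : N -> R) (x : N) :
    'cV[R]_(mdim N) :=
  \col_i partial i (fun y => f (bwd (chart_at x) y)) (fwd (chart_at x) x).

(* The derivative X(f) of [f] along the tangent vector [X] at [x]. *)
Definition along (R : realType) (N : mdata R) (x : N) (X : 'rV[R]_(mdim N))
    (f : N -> R) : R :=
  (X *m dfun f x) 0 0.

(* c'(0) *)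
Definition velocity (R : realType) (N : mdata R) (c : R -> N) :
    'rV[R]_(mdim N) :=
  \row_i derive1 (fun t : R => fwd (chart_at (c 0)) (c t) 0 i) 0.

Definition submersion (R : realType) (N P : mdata R) (f : N -> P) :=
  smooth_map f /\ forall x, \rank (tmap f x) = mdim P.

(* For a subset S (a Lie group with unit e for the product mul), the curve
   t |-> Exp(tX), i.e. the one-parameter subgroup with initial velocity X. *)
Definition Exp (R : realType) (N : mdata R) (mul : N -> N -> N) (S : set N)
    (e : N) (X : 'rV[R]_(mdim N)) : R -> N :=
  xget (fun=> e : N) [set c : R -> N |
    [/\ @smooth_map R (real_line R) N c, forall t, S (c t), c 0 = e,
        forall s t, c (s + t) = mul (c s) (c t) & velocity c = X]].

(* [src] is alpha and [tgt] is beta; [mul g h] is meaningful when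
   [src g = tgt h]. *)
Record lie_groupoid (R : realType) (M : mdata R) := LieGroupoid {
  arr :> mdata R;
  src : arr -> M;
  tgt : arr -> M;
  mul : arr -> arr -> arr;
  one : M -> arr;
  inv : arr -> arr;
  arr_manifold : manifold arr;
  src_submersion : submersion src;
  tgt_submersion : submersion tgt;
  one_smooth : smooth_map one;
  inv_smooth : smooth_map inv;
  mul_smooth : @smooth_map_in R (prod_mfd arr arr) arr
    [set z | src z.1 = tgt z.2] (fun z => mul z.1 z.2);
  src_one : forall p, src (one p) = p;
  tgt_one : forall p, tgt (one p) = p;
  src_mul : forall g h, src g = tgt h -> src (mul g h) = src h;
  tgt_mul : forall g h, src g = tgt h -> tgt (mul g h) = tgt g;
  mulA : forall g h k, src g = tgt h -> src h = tgt k ->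
    mul g (mul h k) = mul (mul g h) k;
  mul1 : forall g, mul (one (tgt g)) g = g;
  mulone : forall g, mul g (one (src g)) = g;
  src_inv : forall g, src (inv g) = tgt g;
  tgt_inv : forall g, tgt (inv g) = src g;
  mulV : forall g, mul g (inv g) = one (tgt g);
  mulVl : forall g, mul (inv g) g = one (src g) }.

Arguments src {R M} _ _.
Arguments tgt {R M} _ _.
Arguments mul {R M} _ _ _.
Arguments one {R M} _ _.
Arguments inv {R M} _ _.

Definition regular (R : realType) (M : mdata R) (G : lie_groupoid M) :=
  exists r, forall g : G,
    \rank (row_mx (tmap (tgt G) g) (tmap (src G) g)) = r.

Definition isotropy (R : realType) (M : mdata R) (G : lie_groupoid M) (p : M) :
    set G :=
  [set g | src G g = p /\ tgt G g = p].

(* The fibre of AI_G at p: the tangent space at 1_p of the isotropy group. *)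
Definition AI (R : realType) (M : mdata R) (G : lie_groupoid M) (p : M) :
    set 'rV[R]_(mdim G) :=
  [set X | exists c : R -> G,
    [/\ @smooth_map R (real_line R) G c, forall t, isotropy p (c t),
        c 0 = one G p & X = velocity c]].

Definition Ad (R : realType) (M : mdata R) (G : lie_groupoid M) (g : G)
    (X : 'rV[R]_(mdim G)) : 'rV[R]_(mdim G) :=
  let p := src G g in
  velocity (fun t =>
    mul G (mul G g (Exp (mul G) (isotropy p) (one G p) X t)) (inv G g)).

(* Elements of A^*I_G over p are linear forms on [AI p], represented by
   functions vanishing outside of [AI p]. *)
Definition covec (R : realType) (M : mdata R) (G : lie_groupoid M) :=
  'rV[R]_(mdim G) -> R.

Definition is_covec (R : realType) (M : mdata R) (G : lie_groupoid M) (p : M)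
    (eta : covec G) :=
  (forall a X Y, AI (G := G) p X -> AI (G := G) p Y ->
     eta (a *: X + Y) = a * eta X + eta Y) /\
  forall X, ~ AI (G := G) p X -> eta X = 0.

Definition Adstar (R : realType) (M : mdata R) (G : lie_groupoid M) (g : G)
    (eta : covec G) : covec G :=
  patch (fun=> 0) (AI (G := G) (tgt G g)) (fun X => eta (Ad (inv G g) X)).

Definition smooth_AI_section (R : realType) (M : mdata R) (G : lie_groupoid M)
    (X : M -> 'rV[R]_(mdim G)) :=
  (forall p, AI (G := G) p (X p)) /\
  forall f : G -> R, smooth_fun f ->
    smooth_fun (fun p => along (one G p) (X p) f).

Definition smooth_AIdual_section (R : realType) (M : mdata R)
    (G : lie_groupoid M) (xi : M -> covec G) :=
  (forall p, is_covec p (xi p)) /\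
  forall X, smooth_AI_section (G := G) X -> smooth_fun (fun p => xi p (X p)).

Definition stabilizer (R : realType) (M : mdata R) (G : lie_groupoid M)
    (xi : M -> covec G) : set G :=
  [set g | Adstar g (xi (src G g)) = xi (tgt G g)].

Definition lie_subgroupoid (R : realType) (M : mdata R) (G : lie_groupoid M)
    (S : set G) :=
  exists (H : lie_groupoid M) (i : H -> G),
    [/\ smooth_map i /\ (forall x, \rank (tmap i x) = mdim H),
        injective i /\ range i = S,
        (forall x, src G (i x) = src H x) /\ (forall x, tgt G (i x) = tgt H x),
        forall x y, src H x = tgt H y -> i (mul H x y) = mul G (i x) (i y)
      & forall p, i (one H p) = one G p].

Definition normal_lie_subgroupoid (R : realType) (M : mdata R)
    (G : lie_groupoid M) (S : set G) :=
  lie_subgroupoid S /\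
  forall n g : G, S n -> src G n = tgt G n -> src G g = src G n ->
    S (mul G (mul G g n) (inv G g)).

(* Q is the image of the map q, with the quotient manifold structure: k is q
   viewed as a map onto Q, and j is the inclusion of Q. *)
Definition quotient_mfd (R : realType) (N Q : mdata R) (T : Type) (q : N -> T)
    (k : N -> Q) (j : Q -> T) :=
  [/\ injective j, forall x, j (k x) = q x, forall y, exists x, k x = y
    & submersion k].

(* The groupoid O(xi), whose elements are pairs (base point, covector). *)
Definition coadjoint_groupoid (R : realType) (M : mdata R)
    (G : lie_groupoid M) (xi : M -> covec G) (O : lie_groupoid M)
    (k : G -> O) (j : O -> M * covec G) :=
  [/\ quotient_mfd (fun g => (tgt G g, Adstar g (xi (src G g)))) k j,
      (forall g, src O (k g) = src G g) /\ (forall g, tgt O (k g) = tgt G g),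
      forall g h, src G g = tgt G h -> mul O (k g) (k h) = k (mul G g h),
      forall p, one O p = k (one G p)
    & forall g, inv O (k g) = k (inv G g)].

Record lie_group (R : realType) := LieGroup {
  elt :> mdata R;
  gmul : elt -> elt -> elt;
  gone : elt;
  ginv : elt -> elt;
  elt_manifold : manifold elt;
  gmul_smooth : @smooth_map R (prod_mfd elt elt) elt (fun z => gmul z.1 z.2);
  ginv_smooth : smooth_map ginv;
  gmulA : forall a b c, gmul a (gmul b c) = gmul (gmul a b) c;
  gmul1 : forall a, gmul gone a = a;
  gmulone : forall a, gmul a gone = a;
  gmulV : forall a, gmul a (ginv a) = gone;
  gmulVl : forall a, gmul (ginv a) a = gone }.

Arguments gmul {R} _ _ _.
Arguments gone {R} _.
Arguments ginv {R} _ _.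

Definition lie_alg (R : realType) (K : lie_group R) := 'rV[R]_(mdim K).
Definition lie_dual (R : realType) (K : lie_group R) :=
  'Hom('rV[R]_(mdim K), R^o).

(* The left-invariant vector field of value V at the unit, as a derivation. *)
Definition left_field (R : realType) (K : lie_group R) (V : lie_alg K)
    (f : K -> R) (a : K) : R :=
  along (gone K) V (fun b => f (gmul K a b)).

Definition lie_bracket (R : realType) (K : lie_group R) (V W : lie_alg K) :
    lie_alg K :=
  xget (0 : 'rV[R]_(mdim K)) [set Z | forall f : K -> R, smooth_fun f ->
    along (gone K) Z f =
    along (gone K) V (left_field W f) - along (gone K) W (left_field V f)].

Definition gExp (R : realType) (K : lie_group R) (V : lie_alg K) : R -> K :=
  Exp (gmul K) setT (gone K) V.

Definition gAd (R : realType) (K : lie_group R) (a : K) (V : lie_alg K) :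
    lie_alg K :=
  velocity (fun t => gmul K (gmul K a (gExp V t)) (ginv K a)).

(* The maps given to [linfun] in the next two definitions are linear. *)
Definition gAdstar (R : realType) (K : lie_group R) (a : K) (xi : lie_dual K) :
    lie_dual K :=
  linfun (fun V : 'rV[R]_(mdim K) => xi (gAd (ginv K a) V) : R^o).

Definition adstar (R : realType) (K : lie_group R) (V : lie_alg K)
    (xi : lie_dual K) : lie_dual K :=
  linfun (fun W : 'rV[R]_(mdim K) =>
    derive1 (fun t : R => gAdstar (gExp V t) xi W : R) 0 : R^o).

(* O is the co-adjoint orbit O(xi). *)
Definition coadjoint_orbit (R : realType) (K : lie_group R) (xi : lie_dual K)
    (O : mdata R) (k : K -> O) (j : O -> lie_dual K) :=
  manifold O /\ quotient_mfd (fun a => gAdstar a xi) k j.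

(* G = M x O(xi') over M: [theta] is the second projection and the first one is
   the source map, so that AG = ker T(src) at the units is M x T_{xi'}O(xi').
   The product on the second factor is
   (Ad^*_a xi', Ad^*_b xi') |-> Ad^*_{ab} xi'. *)
Definition product_groupoid (R : realType) (M : mdata R) (G : lie_groupoid M)
    (K : lie_group R) (O : mdata R) (k : K -> O) (theta : G -> O) :=
  [/\ @diffeo R G (prod_mfd M O) (fun x => (src G x, theta x)),
      forall p, theta (one G p) = k (gone K)
    & forall x y a b, src G x = tgt G y -> theta x = k a -> theta y = k b ->
        theta (mul G x y) = k (gmul K a b)].

Definition orbit_tangent (R : realType) (K : lie_group R) (xi : lie_dual K)
    (T : {vspace (lie_dual K)}) :=
  forall eta, eta \in T <-> exists V, eta = adstar V xi.

Definition orbit_bracket (R : realType) (K : lie_group R) (xi : lie_dual K)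
    (T : {vspace (lie_dual K)})
    (b : subvs_of T -> subvs_of T -> subvs_of T) :=
  forall V W, b (vsproj T (adstar V xi)) (vsproj T (adstar W xi)) =
              vsproj T (adstar (lie_bracket V W) xi).

Definition smooth_section (R : realType) (M : mdata R) (E : vectType R)
    (X : M -> E) :=
  forall l : 'Hom(E, R^o), smooth_fun (fun p => l (X p) : R).

(* The function rho(X)(k). *)
Definition anchor_along (R : realType) (M : mdata R) (E : vectType R)
    (rho : M -> E -> 'rV[R]_(mdim M)) (X : M -> E) (k : M -> R) (p : M) : R :=
  along p (rho p (X p)) k.

Record lie_algebroid (R : realType) (M : mdata R) (E : vectType R)
    (rho : M -> E -> 'rV[R]_(mdim M))
    (br : (M -> E) -> (M -> E) -> (M -> E)) : Prop := LieAlgebroid {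
  anchor_linear : forall p a u v, rho p (a *: u + v) = a *: rho p u + rho p v;
  anchor_smooth : forall X k, smooth_section X -> smooth_fun k ->
    smooth_fun (anchor_along rho X k);
  br_smooth : forall X Y, smooth_section X -> smooth_section Y ->
    smooth_section (br X Y);
  br_linear : forall a X Y Z, smooth_section X -> smooth_section Y ->
    smooth_section Z ->
    br (fun p => a *: X p + Y p) Z = (fun p => a *: br X Z p + br Y Z p);
  br_skew : forall X Y, smooth_section X -> smooth_section Y ->
    br X Y = (fun p => - br Y X p);
  br_jacobi : forall X Y Z, smooth_section X -> smooth_section Y ->
    smooth_section Z -> forall p,
    br X (br Y Z) p + br Y (br Z X) p + br Z (br X Y) p = 0;
  br_leibniz : forall X Y k, smooth_section X -> smooth_section Y ->
    smooth_fun k ->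
    br X (fun p => k p *: Y p) =
      (fun p => k p *: br X Y p + anchor_along rho X k p *: Y p) }.

(* The tangent vector X at 1_p lies in (AG)_p = ker T_{1_p}alpha and
   corresponds to v in T_{xi'}O(xi') under the identification of AG with
   M x T_{xi'}O(xi') induced by that of G with M x O(xi').  *)
Definition algebroid_ident (R : realType) (M : mdata R) (G : lie_groupoid M)
    (K : lie_group R) (O : mdata R) (j : O -> lie_dual K) (theta : G -> O)
    (p : M) (X : 'rV[R]_(mdim G)) (v : lie_dual K) :=
  X *m tmap (src G) (one G p) = 0 /\
  forall W : lie_alg K,
    v W = along (one G p) X (fun x => j (theta x) W : R).

(* The Lie algebroid of the groupoid G = M x O(xi'), on M x T_{xi'}O(xi'). *)
Record coadjoint_algebroid (R : realType) (M : mdata R) (G : lie_groupoid M)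
    (K : lie_group R) (xi : lie_dual K) (O : mdata R) (j : O -> lie_dual K)
    (theta : G -> O) (T : {vspace (lie_dual K)})
    (b : subvs_of T -> subvs_of T -> subvs_of T)
    (rho : M -> subvs_of T -> 'rV[R]_(mdim M))
    (br : (M -> subvs_of T) -> (M -> subvs_of T) -> (M -> subvs_of T)) :
    Prop := CoadjointAlgebroid {
  coalg_lie : lie_algebroid rho br;
  coalg_anchor : forall p X (v : subvs_of T),
    algebroid_ident j theta p X (vsval v) ->
    rho p v = X *m tmap (tgt G) (one G p);
  coalg_tangent : orbit_tangent xi T;
  coalg_bracket : orbit_bracket xi b;
  coalg_const : forall u v, br (fun=> u) (fun=> v) = (fun=> b u v) }.

(* A bivector field, given by its components in the preferred charts. *)
Definition bivector (R : realType) (N : mdata R) := N -> 'M[R]_(mdim N).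

(* {F, K} = Pi(dF, dK) *)
Definition pbracket (R : realType) (N : mdata R) (Pi : bivector N)
    (F K : N -> R) (z : N) : R :=
  ((dfun F z)^T *m Pi z *m dfun K z) 0 0.

Record poisson_structure (R : realType) (N : mdata R) (Pi : bivector N) :
    Prop := PoissonStructure {
  pi_skew : forall z, (Pi z)^T = - Pi z;
  pi_smooth : forall F K, smooth_fun F -> smooth_fun K ->
    smooth_fun (pbracket Pi F K);
  pi_jacobi : forall F K L, smooth_fun F -> smooth_fun K -> smooth_fun L ->
    forall z, pbracket Pi F (pbracket Pi K L) z +
              pbracket Pi K (pbracket Pi L F) z +
              pbracket Pi L (pbracket Pi F K) z = 0 }.

(* X_H(F) = {F, H} *)
Definition hamiltonian_field (R : realType) (N : mdata R) (Pi : bivector N)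
    (H F : N -> R) : N -> R :=
  pbracket Pi F H.

Definition first_integral (R : realType) (N : mdata R) (Pi : bivector N)
    (H F : N -> R) :=
  forall z, hamiltonian_field Pi H F z = 0.

(* The dual of E as a manifold, with the linear coordinates y_a(l) = l(e_a)
   associated with a basis e of E. *)
Definition dual_mfd (R : realType) (E : vectType R) m (e : m.-tuple E) :
    mdata R :=
  @global_chart_mfd R 'Hom(E, R^o) m
    (fun l => \row_a l (tnth e a))
    (fun y => linfun (fun v : E => \sum_a y 0 a * coord e a v : R^o)).

Definition hat (R : realType) (M : mdata R) (E : vectType R) (X : M -> E)
    (delta : M * 'Hom(E, R^o)) : R :=
  delta.2 (X delta.1).

Record linear_poisson (R : realType) (M : mdata R) (E : vectType R) m
    (e : m.-tuple E) (rho : M -> E -> 'rV[R]_(mdim M))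
    (br : (M -> E) -> (M -> E) -> (M -> E))
    (Pi : bivector (prod_mfd M (dual_mfd e))) : Prop := LinearPoisson {
  linpi_poisson : poisson_structure Pi;
  linpi_sections : forall X Y, smooth_section X -> smooth_section Y ->
    pbracket Pi (hat X) (hat Y) = (fun z => - hat (br X Y) z);
  linpi_anchor : forall k X, smooth_fun k -> smooth_section X ->
    pbracket Pi (fun z => k z.1) (hat X) =
    (fun z => anchor_along rho X k z.1);
  linpi_base : forall k l : M -> R, smooth_fun k -> smooth_fun l ->
    pbracket Pi (fun z => k z.1) (fun z => l z.1) = (fun=> 0) }.

(* Components of - 1/2 C^c_{ab} y_c d/dy_a /\ d/dy_b, where
   b(e_a, e_b) = C^c_{ab} e_c and
   (d/dy_a /\ d/dy_b)(df, dg) = (df/dy_a)(dg/dy_b) - (df/dy_b)(dg/dy_a). *)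
Definition kirillov_kostant (R : realType) (E : vectType R) m (e : m.-tuple E)
    (b : E -> E -> E) : bivector (dual_mfd e) :=
  fun l => - 2^-1 *: \sum_(i < m) \sum_(j < m) \sum_(c < m)
    (coord e c (b (tnth e i) (tnth e j)) * l (tnth e c)) *:
      (delta_mx i j - delta_mx j i).

(* Main.v *)
Require Import Defs.
From HB Require Import structures.
From mathcomp Require Import all_boot all_order all_algebra.
From mathcomp Require Import all_classical all_reals all_analysis.
From mathcomp Require Import lra.
Set Implicit Arguments.
Unset Strict Implicit.
Unset Printing Implicit Defensive.
Import Order.TTheory GRing.Theory Num.Theory numFieldNormedType.Exports.
Local Open Scope classical_set_scope.
Local Open Scope ring_scope.

(** In linear coordinates on the dual of [T_{xi'}O(xi')], both Poisson tensors
    have the same components along the fibre.  A function pulled back from the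
    fibre has no derivative in the directions of M, so a bracket of two such
    functions only sees the fibre-fibre block of [Pi] ([pbracket_snd]).  That
    block is read off from the brackets of the coordinate functions, which are
    the functions [hat X] of the constant sections X with values in the basis;
    as the bracket of constant sections is the constant section given by the
    bracket of the fibre, the block is exactly the Kirillov-Kostant tensor
    ([linear_poisson_fibre_block]).  Hence
      [{f o snd, h o snd} (p, l) = {f, h}_KK l]
    for all p and l, and the two Hamiltonian derivatives vanish together; that
    M is nonempty is what allows one to return from the product to the fibre.
    The skewness of the fibre bracket, which the Kirillov-Kostant formula
    needs, comes from that of the algebroid bracket on constant sections. *)

Lemma smooth_fun_cst (R : realType) (N : mdata R) (c : R) :
  @smooth_fun R N (fun=> c).
Proof.
move=> phi _ k; move: (fwd phi @` dom phi) => U.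
elim: k c => [|k IHk] c /=; split=> //; try by move=> x _; exact: cst_continuous.
move=> i; split; first by move=> x _; exact: derivable_cst.
rewrite (_ : partial i _ = fun=> 0) //.
by apply/funext => x; rewrite /partial derive1E derive_cst.
Qed.

Lemma smooth_section_cst (R : realType) (M : mdata R) (E : vectType R) (u : E) :
  smooth_section (fun _ : M => u).
Proof. by move=> l; exact: smooth_fun_cst. Qed.

Lemma dfun_snd (R : realType) (N P : mdata R) (f : P -> R) (z : prod_mfd N P) :
  dfun (N := prod_mfd N P) (fun w => f w.2) z = col_mx 0 (dfun f z.2).
Proof.
apply/matrixP => i j; rewrite ord1 {j} mxE /partial /=.
case: (split_ordP i) => {}i ->; rewrite ?col_mxEu ?col_mxEd.
- rewrite mxE (_ : (fun t => _) = fun=> f (bwd (chart_at z.2)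
                                  (fwd (chart_at z.2) z.2))).
    by rewrite derive1E derive_cst.
  apply/funext => t; congr (f (bwd _ _)); apply/rowP => k.
  by rewrite 2!mxE row_mxEr !mxE eq_rlshift andbF mulr0 addr0.
- rewrite mxE /partial; congr (derive1 _ 0).
  apply/funext => t; congr (f (bwd _ _)); apply/rowP => k.
  by rewrite 2!mxE row_mxEr !mxE eq_rshift.
Qed.

Lemma pbracket_snd (R : realType) (N P : mdata R)
    (Pi : bivector (prod_mfd N P)) (f h : P -> R) (z : prod_mfd N P) :
  pbracket Pi (fun w => f w.2) (fun w => h w.2) z =
  ((dfun f z.2)^T *m
     drsubmx (Pi z : 'M[R]_(mdim N + mdim P, mdim N + mdim P)) *m
   dfun h z.2) 0 0.
Proof.
rewrite /pbracket !dfun_snd.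
rewrite -[in LHS](@submxK _ (mdim N) (mdim P) (mdim N) (mdim P) (Pi z)).
by rewrite tr_col_mx trmx0 mul_row_block !mul0mx !add0r mul_row_col mulmx0 add0r.
Qed.

Section DualCoordinates.
Variables (R : realType) (E : vectType R) (m : nat) (e : m.-tuple E).
Hypothesis he : basis_of {: E} e.

Lemma dual_coordK (y : 'rV[R]_m) (a : 'I_m) :
  (linfun (fun v : E => \sum_i y 0 i * coord e i v : R^o) : 'Hom(E, R^o))
    (tnth e a) = y 0 a.
Proof.
pose g (v : E) : R^o := \sum_i y 0 i * coord e i v.
have g_lin : linear g.
  move=> c u v; rewrite /g scaler_sumr -big_split /=.
  by apply: eq_bigr => i _; rewrite linearP mulrDr mulrCA.
pose gL : {linear E -> R^o} := HB.pack g (GRing.isLinear.Build _ _ _ _ g g_lin).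
rewrite -[linfun _]/(linfun gL) lfunE /= /g (bigD1 a) //= (tnth_nth 0).
rewrite !coord_free ?(basis_free he) // eqxx mulr1 big1 ?addr0 // => i ia.
by rewrite coord_free ?(basis_free he) // eq_sym (negPf ia) mulr0.
Qed.

Lemma dfun_dual_coord (a : 'I_m) (l : 'Hom(E, R^o)) :
  dfun (N := dual_mfd e) (fun l' : 'Hom(E, R^o) => l' (tnth e a) : R) l =
  delta_mx a 0.
Proof.
apply/colP => i; rewrite !mxE /partial eqxx andbT /=.
rewrite (_ : (fun t : R => _) =
             fun t => l (tnth e a) + t * ((i == a)%:R)).
  rewrite derive1E deriveD ?derive_cst; [|by []..].
  by rewrite deriveM // derive_id derive_cst scaler0 !add0r /GRing.scale /= mulr1.
by apply/funext => t; rewrite dual_coordK !mxE eqxx /= eq_sym.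
Qed.

(** The 1/2 in the bivector compensates for each pair of indices being met
    twice in the double sum, which is where skewness of the bracket enters. *)
Lemma kirillov_kostantE (b : E -> E -> E)
    (b_skew : forall u v, b u v = - b v u) (l : 'Hom(E, R^o))
    (i j : 'I_m) :
  kirillov_kostant (e := e) b l i j = - l (b (tnth e i) (tnth e j)).
Proof.
pose c (i' j' : 'I_m) : R := l (b (tnth e i') (tnth e j')).
have cE i' j' : c i' j' =
    \sum_(k < m) coord e k (b (tnth e i') (tnth e j')) * l (tnth e k).
  rewrite /c {1}(coord_basis he (memvf (b (tnth e i') (tnth e j')))).
  rewrite linear_sum; apply: eq_bigr => k _.
  by rewrite linearZ /= -tnth_nth.
have -> : kirillov_kostant (e := e) b l =
    - 2^-1 *: ((\matrix_(i', j') c i' j') - (\matrix_(i', j') c i' j')^T).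
  congr (_ *: _); rewrite [in RHS](matrix_sum_delta (\matrix_(i', j') c i' j')).
  rewrite linear_sum -sumrB; apply: eq_bigr => i' _.
  rewrite linear_sum -sumrB; apply: eq_bigr => j' _.
  by rewrite -scaler_suml -cE linearZ /= trmx_delta mxE -scalerBr.
rewrite !mxE (_ : c j i = - c i j); last by rewrite /c b_skew linearN.
rewrite /c opprK; move: (l _) => x; by lra.
Qed.

(** The coordinate functions of the fibre are the functions [hat X] for X
    constant with value a basis vector, so their mutual brackets give the
    entries of the fibre-fibre block. *)
Lemma linear_poisson_fibre_block (M : mdata R)
    (rho : M -> E -> 'rV[R]_(mdim M))
    (br : (M -> E) -> (M -> E) -> (M -> E)) (b : E -> E -> E)
    (b_skew : forall u v, b u v = - b v u)
    (br_cst : forall u v, br (fun=> u) (fun=> v) = (fun=> b u v))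
    (Pi : bivector (prod_mfd M (dual_mfd e)))
    (hPi : linear_poisson rho br Pi) (z : prod_mfd M (dual_mfd e)) :
  drsubmx (Pi z : 'M[R]_(mdim M + m, mdim M + m)) =
  kirillov_kostant (e := e) b z.2.
Proof.
apply/matrixP => i j; rewrite kirillov_kostantE //.
have := linpi_sections hPi (smooth_section_cst (tnth e i))
          (smooth_section_cst (tnth e j)).
rewrite br_cst => /(congr1 (fun F => F z)); rewrite /hat => <-.
rewrite (pbracket_snd Pi (fun l : dual_mfd e => l (tnth e i) : R)
           (fun l : dual_mfd e => l (tnth e j) : R)).
by rewrite !dfun_dual_coord trmx_delta -rowE -colE !mxE.
Qed.

End DualCoordinates.

Theorem proposition26 (R : realType) (M : mdata R) (hM : manifold M)
  (G : lie_groupoid M) (hG : regular G)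
  (xi : M -> covec G) (hxi : smooth_AIdual_section xi)
  (hnormal : normal_lie_subgroupoid (stabilizer xi))
  (coG : lie_groupoid M) (kG : G -> coG) (jG : coG -> M * covec G)
  (hcoG : coadjoint_groupoid xi kG jG)
  (K : lie_group R) (xi' : lie_dual K)
  (O : mdata R) (kO : K -> O) (jO : O -> lie_dual K)
  (hO : coadjoint_orbit xi' kO jO)
  (theta : coG -> O) (hprod : product_groupoid kO theta)
  (T : {vspace (lie_dual K)}) (b : subvs_of T -> subvs_of T -> subvs_of T)
  (rho : M -> subvs_of T -> 'rV[R]_(mdim M))
  (br : (M -> subvs_of T) -> (M -> subvs_of T) -> (M -> subvs_of T))
  (hA : coadjoint_algebroid xi' jO theta b rho br)
  (m : nat) (e : m.-tuple (subvs_of T)) (he : basis_of {: subvs_of T} e)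
  (Pi : bivector (prod_mfd M (dual_mfd e)))
  (hPi : linear_poisson rho br Pi)
  (h f : 'Hom(subvs_of T, R^o) -> R)
  (hh : @smooth_fun R (dual_mfd e) h) (hf : @smooth_fun R (dual_mfd e) f) :
  first_integral Pi (fun z => h z.2) (fun z => f z.2) <->
  first_integral (kirillov_kostant (e := e) b) h f.
Proof.
have [p0 _] := mfd_nonempty hM.
have b_skew u v : b u v = - b v u.
  have := br_skew (coalg_lie hA) (smooth_section_cst (M := M) u)
            (smooth_section_cst v).
  by rewrite !(coalg_const hA) => /(congr1 (fun X => X p0)).
have bracketE z : pbracket Pi (fun z => f z.2) (fun z => h z.2) z =
                  pbracket (kirillov_kostant (e := e) b) f h z.2.
  by rewrite pbracket_snd
       (linear_poisson_fibre_block he b_skew (coalg_const hA) hPi).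
rewrite /first_integral /hamiltonian_field; split=> fh0 z.
- by rewrite -(bracketE (p0, z)) fh0.
- by rewrite bracketE fh0.
Qed.
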